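(* Let $(X,d_X,\mu_X)$ be a bounded metric measure space with $\mu_X(X)=1$, and let $\lambda>0$. (1) If $f$ is a bounded Lipschitz function with mean zero on $X$, then $$\mathrm{diam}(X)\ \ge\ \frac{\ln\int_X \exp(\lambda f(x))\,d\mu_X}{\lambda\,\|f\|_{\mathrm{Lip}}}.$$ (2) In particular, for bounded $1$-Lipschitz functions with mean zero on $X$, $$\mathrm{diam}(X)\ \ge\ \frac{\sqrt{2\ln \mathrm{E}_{(X,d_X,\mu_X)}(\lambda)}}{\lambda}.$$ (3) Consequently $$\mathrm{diam}(X)\ \ge\ \frac1\lambda\,\min\left\{\ln \mathrm{E}_{(X,d_X,\mu_X)}(\lambda),\ \sqrt{2\ln \mathrm{E}_{(X,d_X,\mu_X)}(\lambda)}\right\}.$$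
   Context: A metric measure space $(X,d_X,\mu_X)$ is a metric space with a finite Borel measure $\mu_X$; throughout $\mu_X(X)=1$. $\mathrm{diam}(X)=\sup\{d_X(x,y):x,y\in X\}$. For real-valued $f$ on $X$, $\|f\|_{\mathrm{Lip}}=\sup_{x\ne y}\frac{|f(x)-f(y)|}{d_X(x,y)}$; $f$ is Lipschitz if this is finite and $1$-Lipschitz if it is $\le 1$. Mean zero means $\int_X f\,d\mu_X=0$. The Laplace functional of $\mu_X$ is $\mathrm{E}_{(X,d_X,\mu_X)}(\lambda)=\sup\int_X\exp(\lambda f(x))\,d\mu_X$ for $\lambda>0$, the supremum running over all bounded $1$-Lipschitz functions $f$ with mean zero on $X$. *)

(* Defs.v *)
From HB Require Import structures.
From mathcomp Require Import all_boot all_order all_algebra.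
From mathcomp Require Import all_classical all_reals all_analysis.

Set Implicit Arguments.
Unset Strict Implicit.
Unset Printing Implicit Defensive.

Import Order.TTheory GRing.Theory Num.Theory.
Import numFieldNormedType.Exports.

Local Open Scope classical_set_scope.
Local Open Scope ring_scope.
Local Open Scope ereal_scope.

(* Measurable types are pointed in this library, so the metric spaces that
   carry measures must be as well. Only non-emptiness is at stake: no definition
   below mentions the base point, and a space of total mass 1 is non-empty. *)
#[short(type="pmetricType")]
HB.structure Definition PointedMetric (R : numDomainType) :=
  {X of Metric R X & Pointed X}.

Definition borelType (R : realType) (X : pmetricType R) :=
  g_sigma_algebraType (@open X).

Definition diam (R : realType) (X : pmetricType R) : \bar R :=
  ereal_sup [set (mdist x y)%:E | x in [set: X] & y in [set: X]].

(* 0 is adjoined so that the norm is 0, and not -oo, on a one-point space,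
   where there are no pairs x != y; otherwise it changes nothing. *)
Definition lip_norm (R : realType) (X : pmetricType R) (f : X -> R) : \bar R :=
  ereal_sup ([set 0] `|`
    [set (`|f p.1 - f p.2| / mdist p.1 p.2)%:E
       | p in [set p : X * X | p.1 != p.2]]).

Definition mean_zero (R : realType) (X : pmetricType R)
    (mu : probability (borelType X) R) (f : X -> R) : Prop :=
  \int[mu]_x (f x)%:E = 0.

Definition laplace (R : realType) (X : pmetricType R)
    (mu : probability (borelType X) R) (lambda : R) : \bar R :=
  ereal_sup [set \int[mu]_x (expR (lambda * f x))%:E
    | f in [set f : X -> R |
        [/\ bounded_fun f, lip_norm f <= 1 & mean_zero mu f]]].

(* Main.v *)
Require Import Defs.
From HB Require Import structures.
From mathcomp Require Import all_boot all_order all_algebra.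
From mathcomp Require Import all_classical all_reals all_analysis.
From mathcomp Require Import measurable_realfun ring lra.

Set Implicit Arguments.
Unset Strict Implicit.
Unset Printing Implicit Defensive.

Import Order.TTheory GRing.Theory Num.Theory.
Import numFieldNormedType.Exports.

Local Open Scope classical_set_scope.
Local Open Scope ring_scope.
Local Open Scope ereal_scope.
(** Why the bounds hold. A mean-zero function oscillating by at most [M] satisfies
    [`|f| <= M], because its mean 0 lies within [M] of each of its values
    ([norm_le_oscillation]). For an [L]-Lipschitz [f] one may take
    [M := L * D], with [D] the diameter.

    The first bound follows at once: [expR (lambda * f)] is pointwise at most
    [expR (lambda * L * D)], hence so is its integral.

    The second bound is quadratic in [lambda * D] and needs the mean to be 0
    once more, in the manner of Hoeffding's lemma. On [[- d, d]] with
    [d := lambda * D], the exponential lies below its chord, an affine function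
    with constant term [cosh d] ([expR_le_chord]). Integrating
    [expR (lambda * f)] against this majorant kills the linear term and
    leaves [cosh d], which is at most [expR (d ^+ 2 / 2)]
    ([cosh_le_expR_sqr]). This holds for every competitor in the supremum
    defining the Laplace functional, so its logarithm is at most
    [(lambda * D) ^+ 2 / 2]. The third bound is weaker than the second, as a
    minimum is at most its second argument. *)

(** * Exponential inequalities *)

(** Both sides vanish at 0, and their difference has derivative
    [x * (expR x - expR (- x))], which is nonnegative for [x >= 0]. *)
Lemma sinh_le_mul_cosh (R : realType) (a : R) : (0 <= a ->
  expR a - expR (- a) <= a * (expR a + expR (- a)))%R.
Proof.
move=> a0.
pose psi (x : R) : R :=
  (x * (expR x + expR (- x)) - (expR x - expR (- x)))%R.
have dpsi (x : R) : is_derive x 1%R psi (x * (expR x - expR (- x)))%R.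
  by apply: is_derive_eq; rewrite /GRing.scale/=; ring.
have /(_ 0%R a) : forall x y, (0 <= x -> x <= y -> psi x <= psi y)%R.
  apply: ger0_derive1_ndecry => [x _|x|].
  - by have [] := dpsi x.
  - rewrite in_itv/= andbT => x0; rewrite derive1E; have [_ ->] := dpsi x.
    by rewrite mulr_ge0 ?subr_ge0 ?ler_expR ?(ltW x0)//; lra.
  - apply: continuous_subspaceT => x.
    apply/differentiable_continuous/derivable1_diffP.
    by have [] := dpsi x.
rewrite /psi mul0r oppr0 subrr => /(_ (lexx _) a0).
by rewrite subr0 subr_ge0.
Qed.

(** The function [expR (- (x ^+ 2 / 2)) * cosh x] is 1 at 0 and, by
    [sinh_le_mul_cosh], nonincreasing on the nonnegative half-line. The case
    of negative [a] follows by parity. *)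
Lemma cosh_le_expR_sqr (R : realType) (a : R) :
  ((expR a + expR (- a)) / 2 <= expR (a ^+ 2 / 2))%R.
Proof.
wlog a0 : a / (0 <= a)%R.
  move=> H; have [/H//|/ltW a0] := leP 0%R a.
  by have := H (- a)%R; rewrite opprK sqrrN addrC oppr_ge0; exact.
pose phi (x : R) : R := (expR (- (x ^+ 2 / 2)) * (expR x + expR (- x)))%R.
have dphi (x : R) : is_derive x 1%R phi
   (expR (- (x ^+ 2 / 2)) * (expR x - expR (- x) - x * (expR x + expR (- x))))%R.
  by apply: is_derive_eq; rewrite /GRing.scale/=; field.
have /(_ 0%R a) : forall x y, (0 <= x -> x <= y -> phi y <= phi x)%R.
  apply: ler0_derive1_nincry => [x _|x|].
  - by have [] := dphi x.
  - rewrite in_itv/= andbT => x0; rewrite derive1E; have [_ ->] := dphi x.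
    by rewrite mulr_ge0_le0 ?expR_ge0// subr_le0 sinh_le_mul_cosh// ltW.
  - apply: continuous_subspaceT => x.
    apply/differentiable_continuous/derivable1_diffP.
    by have [] := dphi x.
move=> /(_ (lexx _) a0).
rewrite /phi expr0n/= mul0r oppr0 !expR0 mul1r expRN mulrC.
by rewrite ler_pdivrMr ?expR_gt0// ler_pdivrMr// mulrC.
Qed.

(** Convexity: on [[- d, d]] the exponential lies below the chord through its
    end points. The slope is left existential because only the constant term
    survives integration against a centred measure, and because this
    absorbs the case [d <= 0], where the chord has no well-defined slope. *)
Lemma expR_le_chord (R : realType) (d : R) :
  exists c : R, forall x : R, (`|x| <= d ->
    expR x <= (expR d + expR (- d)) / 2 + c * x)%R.
Proof.
have [d0|d0] := leP d 0%R.
  exists 0%R => x xd; have -> : x = 0%R.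
    by apply/eqP; rewrite -normr_le0 (le_trans xd).
  (* here [1 <= cosh d] comes from adding [1 + x <= expR x] at [d] and [- d] *)
  rewrite expR0 mul0r addr0.
  by have := expR_ge1Dx d; have := expR_ge1Dx (- d)%R; lra.
exists ((expR d - expR (- d)) / (2 * d))%R => x.
rewrite ler_norml => /andP[dx xd].
have t01 : (0 <= (x + d) / (2 * d) <= 1)%R.
  by rewrite divr_ge0/= ?ler_pdivrMr ?mulr_gt0//; lra.
have := convex_expR (Itv01 (andP t01).1 (andP t01).2) d (- d)%R.
rewrite !convRE/= /unstable.onem.
rewrite [X in expR X](_ : _ = x)%R; last by field; rewrite gt_eqF.
move=> /le_trans; apply; rewrite le_eqVlt; apply/orP; left; apply/eqP.
by field; rewrite gt_eqF.
Qed.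

Lemma lne_le_of_le_expR (R : realType) (x : \bar R) (a : R) :
  x <= (expR a)%:E -> lne x <= a%:E.
Proof.
move=> xa; have [x0|x0] := leP x 0; first by rewrite le0_lneNy ?leNye.
rewrite -[in leRHS](expRK a) -lne_EFin ?expR_gt0//.
by rewrite lee_lne// in_itv/= leey andbT ?lee_fin ?expR_ge0// ltW.
Qed.

(** * Mean-zero functions on a probability space *)

Section probability.
Context d (T : measurableType d) (R : realType) (P : probability T R).
Implicit Types f : T -> R.

(** Integrating [f x - M <= f y <= f x + M] over [y] yields
    [f x - M <= 0 <= f x + M]. *)
Lemma norm_le_oscillation f (M : R) :
  P.-integrable setT (EFin \o f) -> \int[P]_x (f x)%:E = 0 ->
  (forall x y, (`|f x - f y| <= M)%R) -> forall x, (`|f x| <= M)%R.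
Proof.
move=> intf f0 fM x.
have icst (c : R) : \int[P]_(y in setT) (cst c%:E) y = c%:E.
  by rewrite integral_cst//= probability_setT mule1.
have intc (c : R) : P.-integrable setT (cst c%:E).
  exact: finite_measure_integrable_cst.
rewrite ler_norml; apply/andP; split.
- have : \int[P]_y (f y)%:E <= \int[P]_(y in setT) (cst (f x + M)%:E) y.
    apply: le_integral => //= y _; rewrite lee_fin.
    by have := fM x y; rewrite ler_norml => /andP[]; lra.
  by rewrite icst f0 !lee_fin; lra.
- have : \int[P]_(y in setT) (cst (f x - M)%:E) y <= \int[P]_y (f y)%:E.
    apply: le_integral => //= y _; rewrite lee_fin.
    by have := fM x y; rewrite ler_norml => /andP[]; lra.
  by rewrite icst f0 !lee_fin; lra.
Qed.

Lemma integral_expR_le f (M lambda : R) : (0 <= lambda)%R ->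
  measurable_fun setT f -> (forall x, (f x <= M)%R) ->
  \int[P]_x (expR (lambda * f x))%:E <= (expR (lambda * M))%:E.
Proof.
move=> l0 mf fM.
apply: (@le_trans _ _ (\int[P]_(x in setT) (cst (expR (lambda * M))%:E) x)).
  apply: ge0_le_integral => //=.
  - apply/measurable_EFinP; apply: measurableT_comp => //.
    exact: measurable_funM.
  - by move=> x _; rewrite lee_fin ler_expR ler_wpM2l.
by rewrite integral_cst//= probability_setT mule1.
Qed.

(** Hoeffding's lemma, with the constant obtained for an interval symmetric
    about the mean: the chord above the exponential integrates to
    [cosh (lambda * M)]. *)
Lemma integral_expR_le_subgaussian f (M lambda : R) : (0 <= lambda)%R ->
  P.-integrable setT (EFin \o f) -> \int[P]_x (f x)%:E = 0 ->
  (forall x, (`|f x| <= M)%R) ->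
  \int[P]_x (expR (lambda * f x))%:E <= (expR ((lambda * M) ^+ 2 / 2))%:E.
Proof.
move=> l0 intf f0 fM.
have mf : measurable_fun setT f.
  by apply/measurable_EFinP; exact: measurable_int intf.
have [c cP] := expR_le_chord (lambda * M).
pose C := ((expR (lambda * M) + expR (- (lambda * M))) / 2)%R.
apply: (@le_trans _ _ (\int[P]_x (C%:E + (c * lambda)%:E * (f x)%:E))).
  apply: ge0_le_integral => //=.
  - apply/measurable_EFinP; apply: measurableT_comp => //.
    exact: measurable_funM.
  - rewrite -[X in measurable_fun _ X]/(fun x => (C + c * lambda * f x)%:E).
    apply/measurable_EFinP; apply: measurable_funD => //.
    exact: measurable_funM.
  - move=> x _; rewrite -EFinM -EFinD lee_fin -mulrA; apply: cP.
    by rewrite normrM (ger0_norm l0) ler_wpM2l.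
rewrite integralD//; last 2 first.
- exact: finite_measure_integrable_cst.
- exact: integrableZl.
rewrite integralZl// f0 mule0 adde0 integral_cst//= probability_setT mule1.
by rewrite lee_fin cosh_le_expR_sqr.
Qed.

End probability.

(** * Lipschitz functions on a metric space *)

Lemma continuous_borel_measurable (R : realType) (X : pmetricType R)
    (f : X -> R) :
  continuous f -> measurable_fun [set: borelType X] f.
Proof.
move=> cf; apply: (measurability _ (RGenOInfty.measurableE R)) => _ [_ [a ->] <-].
rewrite setTI; apply: sub_sigma_algebra.
by apply: open_comp => [x _|]; [exact: cf|exact: interval_open].
Qed.

Section lipschitz.
Context (R : realType) (X : pmetricType R).

Lemma mdist_le_diam (x y : X) : (mdist x y)%:E <= diam X.
Proof. by apply: ereal_sup_ubound; exists x => //; exists y. Qed.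

Lemma lip_norm_ge0 (f : X -> R) : 0 <= lip_norm f.
Proof. by apply: ereal_sup_ubound; left. Qed.

Lemma lip_norm_le (f : X -> R) (L : R) : lip_norm f <= L%:E ->
  forall x y, (`|f x - f y| <= L * mdist x y)%R.
Proof.
move=> fL x y; have [->|xy] := eqVneq x y.
  by rewrite subrr normr0 mdistxx mulr0.
rewrite -ler_pdivrMr ?mdist_gt0// -lee_fin; apply: le_trans fL.
by apply: ereal_sup_ubound; right; exists (x, y).
Qed.

Lemma lipschitz_continuous (f : X -> R) (L : R) :
  (forall x y, (`|f x - f y| <= L * mdist x y)%R) -> continuous f.
Proof.
move=> fL x; apply/cvgrPdist_le => e e0.
(* [`|L| + 1], rather than [L], so that dividing [e] by it is always safe *)
have L0 : (0 < `|L| + 1)%R by rewrite ltr_wpDl.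
near=> y.
have : (mdist x y < e / (`|L| + 1))%R.
  near: y; have := nbhsx_ballx x (e / (`|L| + 1))%R.
  by rewrite ballEmdist; apply; rewrite divr_gt0.
rewrite ltr_pdivlMr// => /ltW; apply: le_trans.
rewrite (le_trans (fL x y))// mulrC ler_wpM2l ?mdist_ge0//.
by rewrite (le_trans (ler_norm L)) ?lerDl.
Unshelve. all: by end_near. Qed.

End lipschitz.

Theorem theorem7p6 (R : realType) (X : pmetricType R)
    (mu : probability (borelType X) R) (lambda : R)
    (X_bounded : diam X < +oo) (lambda_gt0 : (0 < lambda)%R) :
  [/\ forall f : X -> R,
        bounded_fun f -> lip_norm f < +oo -> mean_zero mu f ->
        lne (\int[mu]_x (expR (lambda * f x))%:E) / (lambda%:E * lip_norm f)
          <= diam X,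
      sqrte (2%:E * lne (laplace mu lambda)) / lambda%:E <= diam X
    & lambda^-1%:E * mine (lne (laplace mu lambda))
                          (sqrte (2%:E * lne (laplace mu lambda)))
        <= diam X].
Proof.
have [D DE] : exists D, diam X = D%:E.
  have : 0 <= diam X by have := mdist_le_diam (point : X) point; rewrite mdistxx.
  by move: X_bounded; case: (diam X) => // D; exists D.
have D0 : (0 <= D)%R.
  by have := mdist_le_diam (point : X) point; rewrite mdistxx DE.
have osc (f : X -> R) L : bounded_fun f -> lip_norm f <= L%:E -> (0 <= L)%R ->
    mean_zero mu f -> mu.-integrable [set: borelType X] (EFin \o f) /\
      forall x, (`|f x| <= L * D)%R.
  move=> bf fL L0 f0; have lf := lip_norm_le fL.
  have intf : mu.-integrable [set: borelType X] (EFin \o f).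
    apply: measurable_bounded_integrable => //.
    - by rewrite /= probability_setT ltry.
    - exact: continuous_borel_measurable (lipschitz_continuous lf).
  split=> //; apply: (norm_le_oscillation intf f0) => x y.
  by rewrite (le_trans (lf x y))// ler_wpM2l// -lee_fin -DE mdist_le_diam.
have le_diam : sqrte (2%:E * lne (laplace mu lambda)) / lambda%:E <= diam X.
  have EL : laplace mu lambda <= (expR ((lambda * D) ^+ 2 / 2))%:E.
    apply: ge_ereal_sup => _ [f [bf f1 f0] <-].
    have [intf fD] := osc f 1%R bf f1 ler01 f0.
    apply: (integral_expR_le_subgaussian (ltW lambda_gt0) intf f0) => x.
    by rewrite -[D]mul1r.
  have {EL} := lne_le_of_le_expR EL.
  rewrite inver gt_eqF// lee_pdivrMr// DE.
  have -> : D%:E * lambda%:E = sqrte ((lambda * D) ^+ 2)%:E.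
    by rewrite -EFinM mulrC /= sqrtr_sqr ger0_norm // mulr_ge0 // ltW.
  move=> lnE; rewrite lee_sqrt ?lee_fin ?sqr_ge0// -lee_pdivlMl//.
  by rewrite -EFinM mulrC.
split=> //.
- move=> f bf fy f0.
  have [L LE] : exists L, lip_norm f = L%:E.
    by have := lip_norm_ge0 f; move: fy; case: (lip_norm f) => // L; exists L.
  have L0 : (0 <= L)%R by rewrite -lee_fin -LE lip_norm_ge0.
  have [|intf fLD] := osc f L bf _ L0 f0; first by rewrite LE.
  have : \int[mu]_x (expR (lambda * f x))%:E <= (expR (lambda * (L * D)))%:E.
    apply: integral_expR_le; [exact: ltW| |].
    - by apply/measurable_EFinP; exact: measurable_int intf.
    - by move=> x; rewrite (le_trans (ler_norm _)).
  set I := \int[mu]_x _ => IE.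
  have lnI := lne_le_of_le_expR IE.
  rewrite LE -EFinM inver mulf_eq0 gt_eqF//=; case: eqVneq => [L_0|Ln0].
    (* [f] is then constant: the denominator is 0, its inverse [+oo], and the
       quotient is at most 0 since the logarithm is *)
    move: lnI; rewrite L_0 mul0r mulr0 => lnI.
    by rewrite (@le_trans _ _ 0)// ?DE// mule_le0_ge0// leey.
  have Lpos : (0 < L)%R by rewrite lt_neqAle eq_sym Ln0.
  by rewrite lee_pdivrMr ?mulr_gt0// DE -EFinM mulrC -mulrA.
- apply: le_trans le_diam; rewrite inver gt_eqF// muleC lee_wpmul2r//.
  + by rewrite lee_fin invr_ge0 ltW.
  + by rewrite ge_min lexx orbT.
Qed.
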